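(* Let $G=\langle L\mid R\rangle$ be a positive homogeneously presented group, and let $G^+=\langle L\mid R\rangle_{mo}$ be the associated monoid. Assume that $G^+$ is cancellative and $\mathcal{F}(G^+)\neq\emptyset$. Then: (1) The localization homomorphism $\pi:G^+\to G$ is injective. (2) The word problem in $G$ is solvable. (3) The conjugacy problem in $G^+$ is solvable if and only if the conjugacy problem in $G$ is solvable.
   Context: $L$ is a finite set and $R$ a finite set of relations $R_i=S_i$ where $R_i,S_i$ are positive words (words in the free monoid $L^*$) of the same length (this is what positive homogeneously presented means). $G$ is the group with this presentation, and $G^+=\langle L\mid R\rangle_{mo}$ is the quotient of $L^*$ by the congruence generated by $R$. The localization homomorphism $\pi:G^+\to G$ is the natural homomorphism. $G^+$ is cancellative if $AXB=AYB$ implies $X=Y$. A generator $g\in L$ is a dummy generator if $R$ contains a relation $g=w$ with $w$ a positive word in the generators other than $g$; $\widetilde L$ is the set of non-dummy generators. Its image in $G^+$ is the set of all atoms (indecomposable elements $\neq 1$), and $\widetilde L$ is identified with this image. A fundamental element is an element $\Delta\in G^+$ for which there is a permutation $\sigma$ of $\widetilde L$ such that for every $s\in\widetilde L$ there is $\Delta_s\in G^+$ with $\Delta=s\cdot\Delta_s=\Delta_s\cdot\sigma(s)$; $\mathcal{F}(G^+)$ is the set of fundamental elements (the identity is not one). The word problem in $G$ is solvable if there is an algorithm deciding whether two given words in the generators and their inverses are equal in $G$; the conjugacy problem in $G$ is solvable if there is an algorithm deciding whether two given such words represent conjugate elements of $G$. The conjugacy problem in $G^+$ is solvable if there is an algorithm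 that, given $U,V\in L^*$, decides whether there is $A\in G^+$ with $AU=VA$ in $G^+$. *)

(* Defs.v *)
From HB Require Import structures.
From mathcomp Require Import all_boot.
From mathcomp Require Import boolp classical_sets functions.

Set Implicit Arguments.
Unset Strict Implicit.
Unset Printing Implicit Defensive.

Local Open Scope group_scope.

(* The congruence generated by the relations u = v, for (u, v) in R.          *)
Inductive cong (X : finType) (R : seq (seq X * seq X)) : seq X -> seq X -> Prop :=
| cong_rel u v : (u, v) \in R -> cong R u v
| cong_refl u : cong R u u
| cong_sym u v : cong R u v -> cong R v u
| cong_trans v u w : cong R u v -> cong R v w -> cong R u w
| cong_cat u u' v v' : cong R u u' -> cong R v v' -> cong R (u ++ v) (u' ++ v').

Definition congb (X : finType) (R : seq (seq X * seq X)) : rel (seq X) :=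
  fun u v => `[< cong R u v >].

Lemma congb_refl (X : finType) (R : seq (seq X * seq X)) : reflexive (congb R).
Proof. by move=> u; apply/asboolP; apply: cong_refl. Qed.

Lemma congb_sym (X : finType) (R : seq (seq X * seq X)) : symmetric (congb R).
Proof. by move=> u v; apply/asboolP/asboolP; apply: cong_sym. Qed.

Lemma congb_trans (X : finType) (R : seq (seq X * seq X)) : transitive (congb R).
Proof.
by move=> v u w /asboolP uv /asboolP vw; apply/asboolP; apply: cong_trans uv vw.
Qed.

Canonical congb_equiv (X : finType) (R : seq (seq X * seq X)) :=
  EquivRel (congb R) (@congb_refl X R) (@congb_sym X R) (@congb_trans X R).

Definition pres_monoid (X : finType) (R : seq (seq X * seq X)) : Type :=
  {eq_quot congb_equiv R}%qT.

HB.instance Definition _ (X : finType) (R : seq (seq X * seq X)) :=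
  Choice.on (pres_monoid R).

Definition wclass (X : finType) (R : seq (seq X * seq X)) (u : seq X) :
  pres_monoid R := \pi_({eq_quot congb_equiv R})%qT u.

Lemma wclass_eq (X : finType) (R : seq (seq X * seq X)) (u v : seq X) :
  wclass R u = wclass R v <-> cong R u v.
Proof.
split=> [/eqP | uv]; first by rewrite piE => /asboolP.
by apply/eqP; rewrite piE; apply/asboolP.
Qed.

Lemma cong_repr (X : finType) (R : seq (seq X * seq X)) (u : seq X) :
  cong R (repr (wclass R u)) u.
Proof. by apply/wclass_eq; rewrite /wclass reprK. Qed.

Definition pres_one (X : finType) (R : seq (seq X * seq X)) : pres_monoid R :=
  wclass R [::].

Definition pres_mul (X : finType) (R : seq (seq X * seq X))
  (a b : pres_monoid R) : pres_monoid R := wclass R (repr a ++ repr b).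

Lemma wclass_repr (X : finType) (R : seq (seq X * seq X)) (a : pres_monoid R) :
  wclass R (repr a) = a.
Proof. exact: reprK. Qed.

Lemma pres_mulE (X : finType) (R : seq (seq X * seq X)) (u v : seq X) :
  pres_mul (wclass R u) (wclass R v) = wclass R (u ++ v).
Proof. by apply/wclass_eq; apply: cong_cat; apply: cong_repr. Qed.

Lemma pres_mulA (X : finType) (R : seq (seq X * seq X)) :
  associative (@pres_mul X R).
Proof.
move=> a b c; rewrite -[a]wclass_repr -[b]wclass_repr -[c]wclass_repr.
by rewrite !pres_mulE catA.
Qed.

Lemma pres_mul1 (X : finType) (R : seq (seq X * seq X)) :
  left_id (pres_one R) (@pres_mul X R).
Proof. by move=> a; rewrite -[a]wclass_repr pres_mulE. Qed.

Lemma pres_mulr1 (X : finType) (R : seq (seq X * seq X)) :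
  right_id (pres_one R) (@pres_mul X R).
Proof. by move=> a; rewrite -[a]wclass_repr pres_mulE cats0. Qed.

HB.instance Definition _ (X : finType) (R : seq (seq X * seq X)) :=
  isMonoid.Build (pres_monoid R)
    (@pres_mulA X R) (@pres_mul1 X R) (@pres_mulr1 X R).

(* A letter (x, false) of a group word stands for x, and (x, true) for x^-1.  *)

Definition pos_word (L : finType) (u : seq L) : seq (L * bool) :=
  [seq (x, false) | x <- u].

Definition neg_letter (L : finType) (l : L * bool) : L * bool :=
  (l.1, ~~ l.2).

Definition inv_word (L : finType) (u : seq (L * bool)) : seq (L * bool) :=
  rev (map (@neg_letter L) u).

Definition group_rels (L : finType) (R : seq (seq L * seq L)) :
    seq (seq (L * bool) * seq (L * bool)) :=
  [seq (pos_word r.1, pos_word r.2) | r <- R]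
  ++ [seq ([:: l; neg_letter l], [::]) | l <- enum {: L * bool}].

Definition pres_group (L : finType) (R : seq (seq L * seq L)) : Type :=
  pres_monoid (group_rels R).

HB.instance Definition _ (L : finType) (R : seq (seq L * seq L)) :=
  Monoid.on (pres_group R).

Definition gclass (L : finType) (R : seq (seq L * seq L)) (u : seq (L * bool)) :
  pres_group R := wclass (group_rels R) u.

Lemma neg_letterK (L : finType) : involutive (@neg_letter L).
Proof. by case=> x b; rewrite /neg_letter /= negbK. Qed.

Lemma inv_wordK (L : finType) : involutive (@inv_word L).
Proof.
by move=> u; rewrite /inv_word map_rev revK (mapK (@neg_letterK L)).
Qed.

Lemma cong_wordV (L : finType) (R : seq (seq L * seq L)) (u : seq (L * bool)) :
  cong (group_rels R) (u ++ inv_word u) [::].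
Proof.
elim: u => [|l u IHu]; first exact: cong_refl.
rewrite /inv_word map_cons rev_cons -cats1 cat_cons -cat1s catA.
apply: (@cong_trans _ _ ([:: l] ++ [:: neg_letter l])).
  rewrite -catA; apply: cong_cat; first exact: cong_refl.
  rewrite catA -[X in cong _ _ X]cat0s.
  by apply: cong_cat; [exact: IHu | exact: cong_refl].
apply: cong_rel; rewrite mem_cat; apply/orP; right.
by apply/mapP; exists l; rewrite // mem_enum.
Qed.

Lemma cong_Vword (L : finType) (R : seq (seq L * seq L)) (u : seq (L * bool)) :
  cong (group_rels R) (inv_word u ++ u) [::].
Proof. by rewrite -{2}[u]inv_wordK; apply: cong_wordV. Qed.

Definition pres_inv (L : finType) (R : seq (seq L * seq L)) (a : pres_group R) :
  pres_group R := gclass R (inv_word (repr a)).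

Lemma pres_mulVg (L : finType) (R : seq (seq L * seq L)) :
  left_inverse 1 (@pres_inv L R) *%g.
Proof.
move=> a; rewrite -{2}[a]wclass_repr.
by apply: etrans (pres_mulE _ _ _) _; apply/wclass_eq; apply: cong_Vword.
Qed.

Lemma pres_mulgV (L : finType) (R : seq (seq L * seq L)) :
  right_inverse 1 (@pres_inv L R) *%g.
Proof.
move=> a; rewrite -{1}[a]wclass_repr.
by apply: etrans (pres_mulE _ _ _) _; apply/wclass_eq; apply: cong_wordV.
Qed.

HB.instance Definition _ (L : finType) (R : seq (seq L * seq L)) :=
  hasInv.Build (pres_group R) (@pres_inv L R).
HB.instance Definition _ (L : finType) (R : seq (seq L * seq L)) :=
  Monoid_isGroup.Build (pres_group R) (@pres_mulVg L R) (@pres_mulgV L R).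

Definition localization (L : finType) (R : seq (seq L * seq L))
  (a : pres_monoid R) : pres_group R := gclass R (pos_word (repr a)).

Lemma cong_pos_word (L : finType) (R : seq (seq L * seq L)) (u v : seq L) :
  cong R u v -> cong (group_rels R) (pos_word u) (pos_word v).
Proof.
elim=> {u v} [u v uvR | u | u v _ | v u w _ + _ | u u' v v' _ uu' _ vv'].
- apply: cong_rel; rewrite mem_cat; apply/orP; left.
  by apply/mapP; exists (u, v).
- exact: cong_refl.
- exact: cong_sym.
- exact: cong_trans.
by rewrite /pos_word !map_cat; apply: cong_cat.
Qed.

Lemma localizationE (L : finType) (R : seq (seq L * seq L)) (u : seq L) :
  localization (wclass R u) = gclass R (pos_word u).
Proof. by apply/wclass_eq; apply: cong_pos_word; apply: cong_repr. Qed.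

Lemma localization1 (L : finType) (R : seq (seq L * seq L)) :
  @localization L R 1 = 1.
Proof. exact: localizationE. Qed.

Lemma localizationM (L : finType) (R : seq (seq L * seq L)) :
  {morph @localization L R : a b / a * b}.
Proof.
move=> a b; rewrite -[a]wclass_repr -[b]wclass_repr.
have -> : wclass R (repr a) * wclass R (repr b) = wclass R (repr a ++ repr b).
  exact: pres_mulE.
rewrite !localizationE /pos_word map_cat; apply: esym; exact: pres_mulE.
Qed.

HB.instance Definition _ (L : finType) (R : seq (seq L * seq L)) :=
  isUMagmaMorphism.Build (pres_monoid R) (pres_group R) (@localization L R)
    (conj (@localization1 L R) (@localizationM L R)).

Definition homogeneous (L : finType) (R : seq (seq L * seq L)) : Prop :=
  forall r, r \in R -> size r.1 = size r.2.

Definition cancellative (M : monoidType) : Prop :=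
  forall a b x y : M, a * x * b = a * y * b -> x = y.

Definition atom (M : monoidType) : set M :=
  [set s | s <> 1 /\ forall x y : M, s = x * y -> x = 1 \/ y = 1].

(* The non-dummy generators of a presentation are identified with the atoms   *)
(* of its monoid, so sigma permutes the atoms; its values elsewhere do not    *)
(* matter. The condition Delta <> 1 only matters when there are no atoms.     *)
Definition fundamental (M : monoidType) : set M :=
  [set Delta | Delta <> 1 /\
    exists2 sigma : M -> M, set_bij (@atom M) (@atom M) sigma &
      forall s, atom s ->
        exists Delta_s : M, Delta = s * Delta_s /\ Delta = Delta_s * sigma s].

(* Syntax of mu-recursive functions, our notion of algorithm: MuComp g h is   *)
(* g(h_1, ..., h_m), and MuMin g is the least y with g(y, v) = 0.             *)
Inductive murec : nat -> Type :=
| MuZero n : murec n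
| MuSucc : murec 1
| MuProj n : 'I_n -> murec n
| MuComp m n : murec m -> ('I_m -> murec n) -> murec n
| MuPrec n : murec n -> murec n.+2 -> murec n.+1
| MuMin n : murec n.+1 -> murec n.

(* The graph of the function f(0, v) = F(v), f(k+1, v) = G(k, f(k, v), v).    *)
Fixpoint prec_graph n (F : n.-tuple nat -> nat -> Prop)
    (G : n.+2.-tuple nat -> nat -> Prop) (k : nat) (v : n.-tuple nat) (y : nat)
    {struct k} : Prop :=
  if k is k'.+1 then
    exists2 z, prec_graph F G k' v z & G [tuple of k' :: z :: v] y
  else F v y.

(* murec_eval f v y: the computation of f on input v halts with output y.     *)
Fixpoint murec_eval n (f : murec n) : n.-tuple nat -> nat -> Prop :=
  match f in murec n return n.-tuple nat -> nat -> Prop with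
  | MuZero _ => fun _ y => y = 0%N
  | MuSucc => fun v y => y = (thead v).+1
  | MuProj _ i => fun v y => y = tnth v i
  | MuComp m _ g h => fun v y =>
      exists2 w : m.-tuple nat,
        forall i, murec_eval (h i) v (tnth w i) & murec_eval g w y
  | MuPrec _ g h => fun v y =>
      prec_graph (murec_eval g) (murec_eval h) (thead v)
        [tuple of behead v] y
  | MuMin _ g => fun v y =>
      murec_eval g [tuple of y :: v] 0%N /\
      forall z, (z < y)%N -> exists t, murec_eval g [tuple of z :: v] t.+1
  end.

(* The alphabet is finite and fixed, so the notion of decidability below does *)
(* not depend on the numbering of its letters.                                *)
Definition word_code (X : finType) (u : seq X) : nat :=
  CodeSeq.code [seq (enum_rank x : nat) | x <- u].

Definition decidable_words (X : finType) (P : seq X -> seq X -> Prop) : Prop :=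
  exists f : murec 2, forall u v : seq X, exists2 b : bool,
    murec_eval f [tuple word_code u; word_code v] b & (b <-> P u v).

Definition word_problem_solvable (L : finType) (R : seq (seq L * seq L)) : Prop :=
  decidable_words (fun u v : seq (L * bool) => gclass R u = gclass R v).

Definition group_conjugacy_solvable (L : finType) (R : seq (seq L * seq L)) :
    Prop :=
  decidable_words (fun u v : seq (L * bool) =>
    exists c : pres_group R, gclass R v = gclass R u ^ c).

Definition monoid_conjugacy_solvable (L : finType) (R : seq (seq L * seq L)) :
    Prop :=
  decidable_words (fun U V : seq L =>
    exists A : pres_monoid R, A * wclass R U = wclass R V * A).

(* Main.v *)
Require Import Defs.
From mathcomp Require Import all_boot.
From mathcomp Require Import boolp classical_sets functions.
From mathcomp Require Import zify.

(** Homogeneity makes the length of a word an invariant of its class, so the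
atoms of the monoid M are the classes of the letters. A fundamental element D
then satisfies s D = D (f s) for a map f from letters to letters
([fundamental_intertwines]). The powers of f repeat, say f^i = f^j with i < j,
and cancelling D^i shows that D^(j - i) is central
([fundamental_power_central]). Every letter divides D, so there are a word z
with a central class and words c x with x (c x) = z for every letter x
([central_denominator]).

Hence a group word w is the fraction num w / den w, where x^-1 is written as
c x / z. The relation num w * den w' = num w' * den w in M is compatible with
all defining relations of the group; cancellativity gives transitivity and
centrality gives compatibility with concatenation ([fraction_cong]). On
positive words it is the congruence of M, so M embeds into the group, and in
general it reduces equality in the group to equality in M ([gclass_eq]).
Since denominators are central, a conjugating element can be replaced by its
numerator, so conjugacy in the group also reduces to conjugacy in M
([gclass_conj]). A positive word is its own numerator, with denominator 1, so on
positive words the same equivalence is the converse reduction.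

It remains to see that these reductions, and equality in M, are given by
mu-recursive functions of the codes of words. The reductions are letterwise
substitutions ([computable_flatten_map]). For equality, finite sets of words
are represented by the binary digits of a number. The class of a word u is
finite because congruent words have the same length, and it is the least
number that contains u and is closed under applying a relation inside a word;
minimization finds it ([computable_cong]). *)

Set Implicit Arguments.
Unset Strict Implicit.
Unset Printing Implicit Defensive.

(** * Functions computed by mu-recursive programs *)

(** Inputs range over an arbitrary type I and are presented to the program as
tuples of numbers by e. This covers functions of words, which need only be
computed correctly on genuine codes, and the type I plays the role of a typed
context for the arguments of a program. *)
Definition computable (I : Type) n (e : I -> n.-tuple nat) (f : I -> nat) :=
  exists m : murec n, forall i, murec_eval m (e i) (f i).

Lemma computable_proj (I : Type) n (e : I -> n.-tuple nat) (j : 'I_n) :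
  computable e (fun i => tnth (e i) j).
Proof. by exists (MuProj j). Qed.

(** The general composition rule: the inputs i of the composite are sent by phi
to inputs of g, and h computes the arguments with which g is called. *)
Lemma computable_comp (I J : Type) n k (e : I -> n.-tuple nat)
    (d : J -> k.-tuple nat) (phi : I -> J) (h : 'I_k -> I -> nat) (g : J -> nat) :
  computable d g -> (forall j, computable e (h j)) ->
  (forall i j, tnth (d (phi i)) j = h j i) ->
  computable e (fun i => g (phi i)).
Proof.
move=> [mg mgP] /choice[mh mhP] dE; exists (MuComp mg mh) => i /=.
by exists (d (phi i)) => // j; rewrite dE.
Qed.

Lemma eq_computable (I : Type) n (e : I -> n.-tuple nat) (f g : I -> nat) :
  f =1 g -> computable e f -> computable e g.
Proof. by move=> fg [m mP]; exists m => i; rewrite -fg. Qed.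

(** Adds a bound number to a context, for the programs inside recursions, sums
and minimizations. *)
Definition ext (I : Type) n (e : I -> n.-tuple nat) (p : nat * I) :=
  [tuple of p.1 :: e p.2].

Lemma computable_head (I : Type) n (e : I -> n.-tuple nat) :
  computable (ext e) fst.
Proof.
apply: eq_computable (computable_proj (ext e) ord0) => p.
by rewrite (tnth_nth 0).
Qed.

Lemma computable_weaken (I : Type) n (e : I -> n.-tuple nat) (f : I -> nat) :
  computable e f -> computable (ext e) (fun p => f p.2).
Proof.
move=> cf; apply: (computable_comp (h := fun j p => tnth (e p.2) j) cf) => // j.
apply: eq_computable (computable_proj (ext e) (lift ord0 j)) => p.
by rewrite /ext tnthS.
Qed.

Notation computable1 g := (computable (fun a : nat => [tuple a]) g).
Notation computable2 g :=
  (computable (fun p : nat * nat => [tuple p.1; p.2]) (fun p => g p.1 p.2)).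

Lemma computable_comp1 (I J : Type) n (e : I -> n.-tuple nat) (c : J -> nat)
    (phi : I -> J) (g : J -> nat) :
  computable (fun j => [tuple c j]) g -> computable e (fun i => c (phi i)) ->
  computable e (fun i => g (phi i)).
Proof.
move=> cg cc; apply: (computable_comp (h := fun _ i => c (phi i)) cg) => //.
by move=> i j; rewrite (ord1 j) (tnth_nth 0).
Qed.

Lemma computable_comp2 (I : Type) n (e : I -> n.-tuple nat)
    (op : nat -> nat -> nat) (f g : I -> nat) :
  computable2 op -> computable e f -> computable e g ->
  computable e (fun i => op (f i) (g i)).
Proof.
move=> cop cf cg.
apply: (computable_comp (phi := fun i => (f i, g i))
  (h := fun j : 'I_2 => if j == ord0 then f else g) cop).
  by move=> j; case: ifP.
by move=> i [[|[|j]] lej] //; rewrite (tnth_nth 0).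
Qed.

Lemma computable_const (I : Type) n (e : I -> n.-tuple nat) c :
  computable e (fun=> c).
Proof.
elim: c => [|c IHc]; first by exists (MuZero n).
by apply: (computable_comp1 (c := id) (g := succn) _ IHc); exists MuSucc.
Qed.

Lemma computable_succ (I : Type) n (e : I -> n.-tuple nat) (f : I -> nat) :
  computable e f -> computable e (fun i => (f i).+1).
Proof.
move=> cf; apply: (computable_comp1 (c := id) (g := succn) _ cf).
by exists MuSucc.
Qed.

Lemma computable_iteri (I : Type) n (e : I -> n.-tuple nat) (b F : I -> nat)
    (H : nat -> nat -> I -> nat) :
  computable e b -> computable e F ->
  computable (ext (ext e)) (fun p => H p.1 p.2.1 p.2.2) ->
  computable e (fun i => iteri (b i) (fun k z => H k z i) (F i)).
Proof.
move=> cb [mF mFP] [mH mHP].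
apply: (computable_comp (d := ext e) (phi := fun i => (b i, i))
  (g := fun p => iteri p.1 (fun k z => H k z p.2) (F p.2))
  (h := fun j i => tnth (ext e (b i, i)) j)) => //.
  exists (MuPrec mF mH) => -[k i] /=.
  rewrite /thead (tnth_nth 0) /=.
  have -> : [tuple of behead (k :: e i)] = e i by apply: val_inj.
  elim: k => [|k IHk] /=; first exact: mFP.
  exists (iteri k (fun k z => H k z i) (F i)) => //.
  exact: (mHP (k, (_, i))).
move=> j; case: (unliftP ord0 j) => [{}j|] ->.
  apply: eq_computable (computable_proj e j) => i.
  by rewrite /ext tnthS.
by apply: eq_computable cb => i; rewrite (tnth_nth 0).
Qed.

Lemma computable_min (I : Type) n (e : I -> n.-tuple nat)
    (g : nat -> I -> nat) (f : I -> nat) :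
  computable (ext e) (fun p => g p.1 p.2) ->
  (forall i, g (f i) i = 0) -> (forall i z, z < f i -> g z i != 0) ->
  computable e f.
Proof.
move=> [m mP] g0 gn0; exists (MuMin m) => i /=; split.
  by rewrite -(g0 i); apply: (mP (f i, i)).
move=> z /gn0 gz; exists (g z i).-1; rewrite prednK ?lt0n //.
exact: (mP (z, i)).
Qed.

Lemma computable_fst : computable2 (fun a b => a).
Proof. by exists (MuProj ord0) => -[]. Qed.

Lemma computable_snd : computable2 (fun a b => b).
Proof. by exists (MuProj (lift ord0 ord0)) => -[]. Qed.

Lemma computable_id : computable1 id.
Proof. by exists (MuProj ord0). Qed.

Lemma computable_pred (I : Type) n (e : I -> n.-tuple nat) (f : I -> nat) :
  computable e f -> computable e (fun i => (f i).-1).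
Proof.
apply: (computable_comp1 (c := id) (g := predn)).
apply: (@eq_computable _ _ _ (fun a => iteri a (fun k _ => k) 0)); first by case.
by apply: computable_iteri;
  [apply: computable_id | apply: computable_const | apply: computable_head].
Qed.

Lemma computable_add (I : Type) n (e : I -> n.-tuple nat) (f g : I -> nat) :
  computable e f -> computable e g -> computable e (fun i => f i + g i).
Proof.
move=> cf cg; apply: (@eq_computable _ _ _
  (fun i => iteri (g i) (fun _ z => z.+1) (f i))) => [i|].
  by elim: (g i) => [|k /= ->]; rewrite ?addn0 ?addnS.
apply: computable_iteri => //; apply: computable_succ.
exact: (computable_weaken (computable_head _)).
Qed.

Lemma computable_sub (I : Type) n (e : I -> n.-tuple nat) (f g : I -> nat) :
  computable e f -> computable e g -> computable e (fun i => f i - g i).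
Proof.
move=> cf cg; apply: (@eq_computable _ _ _
  (fun i => iteri (g i) (fun _ z => z.-1) (f i))) => [i|].
  by elim: (g i) => [|k /= ->]; rewrite ?subn0 ?subnS.
apply: computable_iteri => //; apply: computable_pred.
exact: (computable_weaken (computable_head _)).
Qed.

Lemma computable_sum (I : Type) n (e : I -> n.-tuple nat) (b : I -> nat)
    (H : nat -> I -> nat) :
  computable e b -> computable (ext e) (fun p => H p.1 p.2) ->
  computable e (fun i => \sum_(k < b i) H k i).
Proof.
move=> cb cH; apply: (@eq_computable _ _ _
  (fun i => iteri (b i) (fun k z => z + H k i) 0)) => [i|].
  by elim: (b i) => [|k /= ->]; rewrite ?big_ord0 ?big_ord_recr.
apply: computable_iteri => //; first exact: computable_const.
apply: computable_add; first exact: (computable_weaken (computable_head _)).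
(* The summand does not read the accumulator: it is dropped from the context. *)
apply: (computable_comp (d := ext e) (phi := fun p => (p.1, p.2.2))
  (g := fun p => H p.1 p.2) (h := fun j p => tnth (ext e (p.1, p.2.2)) j) cH) => //.
move=> j; case: (unliftP ord0 j) => [{}j|] ->.
  have := computable_weaken (computable_weaken (computable_proj e j)).
  by apply: eq_computable => p; rewrite /ext tnthS.
by apply: eq_computable (computable_head _) => p; rewrite (tnth_nth 0).
Qed.

Lemma computable_sum_seq (I T : Type) n (e : I -> n.-tuple nat) (s : seq T)
    (H : T -> I -> nat) :
  (forall x, computable e (H x)) -> computable e (fun i => \sum_(x <- s) H x i).
Proof.
move=> cH; elim: s => [|x s IHs].
  by apply: (eq_computable _ (computable_const e 0)) => i; rewrite big_nil.
apply: (eq_computable (f := fun i => H x i + \sum_(y <- s) H y i)) => [i|].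
  by rewrite big_cons.
by apply: computable_add.
Qed.

Lemma computable_mul (I : Type) n (e : I -> n.-tuple nat) (f g : I -> nat) :
  computable e f -> computable e g -> computable e (fun i => f i * g i).
Proof.
move=> cf cg; apply: (@eq_computable _ _ _
  (fun i => \sum_(k < f i) g i)) => [i|]; first by rewrite sum_nat_const card_ord.
exact: (computable_sum (H := fun _ i => g i) cf (computable_weaken cg)).
Qed.

Lemma computable_exp2 (I : Type) n (e : I -> n.-tuple nat) (f : I -> nat) :
  computable e f -> computable e (fun i => 2 ^ f i).
Proof.
move=> cf; apply: (@eq_computable _ _ _
  (fun i => iteri (f i) (fun _ z => z + z) 1)) => [i|].
  by elim: (f i) => [|k /= ->] //; rewrite expnS mul2n addnn.
apply: computable_iteri => //; first exact: computable_const.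
by apply: computable_add; apply: (computable_weaken (computable_head _)).
Qed.

Lemma computable_odd (I : Type) n (e : I -> n.-tuple nat) (f : I -> nat) :
  computable e f -> computable e (fun i => odd (f i)).
Proof.
move=> cf; apply: (@eq_computable _ _ _
  (fun i => iteri (f i) (fun _ z => 1 - z) 0)) => [i|].
  by elim: (f i) => [|k /= ->] //; case: odd.
apply: computable_iteri => //; first exact: computable_const.
apply: computable_sub; first exact: computable_const.
exact: (computable_weaken (computable_head _)).
Qed.

Lemma computable_half (I : Type) n (e : I -> n.-tuple nat) (f : I -> nat) :
  computable e f -> computable e (fun i => (f i)./2).
Proof.
move=> cf; apply: (@eq_computable _ _ _
  (fun i => iteri (f i) (fun k z => odd k + z) 0)) => [i|].
  by elim: (f i) => [|k /= ->] //; rewrite uphalf_half.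
apply: computable_iteri => //; first exact: computable_const.
apply: computable_add; first by apply: computable_odd; apply: computable_head.
exact: (computable_weaken (computable_head _)).
Qed.

Lemma computable_nth (s : seq nat) : computable1 (nth 0 s).
Proof.
elim: s => [|a s IHs].
  by apply: (eq_computable _ (computable_const _ 0)) => i; rewrite nth_nil.
apply: (@eq_computable _ _ _ (fun i => iteri i (fun k _ => nth 0 s k) a)).
  by case.
apply: computable_iteri; [exact: computable_id | exact: computable_const |].
exact: computable_comp1 IHs (computable_head _).
Qed.

(** * Finite sets of numbers as binary digits *)

Definition shift i t := iter i half t.
Definition bit i t := odd (shift i t).

Lemma computable_shift (I : Type) n (e : I -> n.-tuple nat) (f g : I -> nat) :
  computable e f -> computable e g -> computable e (fun i => shift (f i) (g i)).
Proof.
move=> cf cg; apply: (@eq_computable _ _ _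
  (fun i => iteri (f i) (fun k z => z./2) (g i))) => [i|].
  by rewrite /shift; elim: (f i) => [|k /= ->].
apply: computable_iteri => //; apply: computable_half.
exact: (computable_weaken (computable_head _)).
Qed.

Lemma computable_bit (I : Type) n (e : I -> n.-tuple nat) (f g : I -> nat) :
  computable e f -> computable e g -> computable e (fun i => bit (f i) (g i)).
Proof. by move=> cf cg; apply: computable_odd; apply: computable_shift. Qed.

Lemma bitS i t : bit i.+1 t = bit i t./2.
Proof. by rewrite /bit /shift iterSr. Qed.

Lemma bit0 i : bit i 0 = false.
Proof. by elim: i => // i; rewrite bitS. Qed.

Lemma bit_leq i t : bit i t -> i <= t.
Proof.
elim: i t => // i IHi [|t]; first by rewrite bit0.
rewrite bitS => /IHi; rewrite ltnS => /leq_trans; apply.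
by rewrite leq_uphalf_double -addnn leq_addr.
Qed.

(** The number of a set is monotone for inclusion, so minimizing the number
finds the least set of a family, if there is one. *)
Lemma leq_bits a b : (forall i, bit i a -> bit i b) -> a <= b.
Proof.
elim/ltn_ind: a b => a IHa b ab.
rewrite -[a]odd_double_half -[b]odd_double_half leq_add ?leq_double //.
  by have := ab 0; rewrite /bit /=; case: (odd a) => // ->.
have [-> //|a_gt0] := posnP a.
apply: IHa => [|i]; last by rewrite -!bitS; apply: ab.
by rewrite ltn_half_double -addnn -[X in X < _]addn0 ltn_add2l.
Qed.

Lemma bits_exist N (P : pred nat) :
  (forall i, P i -> i < N) -> exists t, forall i, bit i t = P i.
Proof.
elim: N P => [|N IHN] P PN.
  exists 0 => i; have -> : P i = false by apply/negP => /PN.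
  exact: bit0.
have [t tP] := IHN (fun i => P i.+1) (fun i Pi => PN i.+1 Pi).
exists (P 0 + t.*2) => -[|i]; first by rewrite /bit /= oddD odd_double addbF oddb.
by rewrite bitS half_bit_double tP.
Qed.

(** * Arithmetic of codes of sequences *)

Import CodeSeq.

(** The number of binary digits of the code of s: each entry n contributes n
digits 0 and one digit 1. *)
Definition codelen (s : seq nat) := sumn s + size s.

Lemma code_cat s t : code (s ++ t) = code s + 2 ^ codelen s * code t.
Proof.
rewrite /codelen; elim: s => [|n s IHs] /=; first by rewrite mul1n.
rewrite IHs -addnA addnS (expnD _ n) expnS doubleD -addSn mulnDr -!mul2n.
by rewrite !mulnA.
Qed.

Lemma code_lt s : code s < 2 ^ codelen s.
Proof.
rewrite /codelen; elim: s => [|n s IHs] //=.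
rewrite -addnA addnS (expnD _ n) expnS ltn_pmul2l ?expn_gt0 //; lia.
Qed.

Lemma codelen_min s i : code s < 2 ^ i -> codelen s <= i.
Proof.
rewrite /codelen; elim: s i => [|n s IHs] //= i lt_i.
have le_n : n < i.
  rewrite -(ltn_exp2l _ _ (leqnn 2)) (leq_ltn_trans _ lt_i) //.
  by rewrite leq_pmulr.
move: lt_i.
rewrite -(subnKC le_n) addSnnS expnD ltn_pmul2l ?expn_gt0 // expnS => lt_i.
by rewrite -addnA leq_add2l addnS ltnS IHs //; lia.
Qed.

Definition codecat a b := a + 2 ^ codelen (decode a) * b.

Lemma codecatE s t : codecat (code s) (code t) = code (s ++ t).
Proof. by rewrite /codecat codeK code_cat. Qed.

(** The length of a code a is the least i with a < 2 ^ i. *)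
Lemma computable_codecat (I : Type) n (e : I -> n.-tuple nat) (f g : I -> nat) :
  computable e f -> computable e g ->
  computable e (fun i => codecat (f i) (g i)).
Proof.
move=> cf cg; apply: computable_add => //; apply: computable_mul => //.
apply: computable_exp2.
apply: (computable_comp1 (c := id) (g := fun a => codelen (decode a)) _ cf).
apply: (computable_min (g := fun i a => a.+1 - 2 ^ i)) => [|a|a i].
- apply: computable_sub; last by apply: computable_exp2; apply: computable_head.
  exact: (computable_succ (computable_weaken computable_id)).
- by apply/eqP; rewrite subn_eq0 -{1}[a]decodeK code_lt.
by apply: contraTN; rewrite subn_eq0 -leqNgt -{1}[a]decodeK => /codelen_min.
Qed.

Lemma shift_exp2 n x : shift n (2 ^ n * x) = x.
Proof.
rewrite /shift; elim: n => [|n IHn] /=; first by rewrite mul1n.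
by rewrite -iterS iterSr expnS -mulnA mul2n doubleK IHn.
Qed.

Definition codehead c := head 0 (decode c).
Definition codetail c := code (behead (decode c)).

Lemma computable_pos (I : Type) n (e : I -> n.-tuple nat) (f : I -> nat) :
  computable e f -> computable e (fun i => 0 < f i).
Proof.
move=> cf; apply: (@eq_computable _ _ _ (fun i => f i - (f i).-1)) => [i|].
  by case: (f i) => // k; rewrite subSnn.
by apply: computable_sub => //; apply: computable_pred.
Qed.

(** The first entry of a sequence is the position of the lowest digit 1 of its
code; on the code 0 of the empty sequence the test holds at once. *)
Lemma computable_codehead (I : Type) n (e : I -> n.-tuple nat) (f : I -> nat) :
  computable e f -> computable e (fun i => codehead (f i)).
Proof.
move=> cf; apply: (computable_comp1 (c := id) (g := codehead) _ cf).
apply: (computable_min (g := fun i a => (0 < a) - bit i a)) => [|a|a i].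
- apply: computable_sub.
    exact: (computable_weaken (computable_pos computable_id)).
  apply: computable_bit; first exact: computable_head.
  exact: (computable_weaken computable_id).
- rewrite -[a]decodeK /codehead codeK /bit; case: (decode a) => // m s /=.
  by rewrite shift_exp2 /= odd_double; case: leq.
rewrite -[a]decodeK /codehead codeK /bit; case: (decode a) => // m s /= lt_in.
rewrite -(subnKC lt_in) addSnnS expnD -mulnA shift_exp2 expnS -mulnA oddM /= subn0.
by rewrite eqb0 negbK !muln_gt0 !expn_gt0.
Qed.

Lemma codetailE c : codetail c = shift (codehead c).+1 c.
Proof.
rewrite -{3}[c]decodeK /codetail /codehead.
case: (decode c) => [//|n s].
rewrite /shift iterS -/(shift _ _) [code (n :: s)]/= shift_exp2.
by rewrite /= uphalf_double.
Qed.

Lemma computable_codetail (I : Type) n (e : I -> n.-tuple nat) (f : I -> nat) :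
  computable e f -> computable e (fun i => codetail (f i)).
Proof.
move=> cf; apply: eq_computable (fun i => esym (codetailE (f i))) _.
by apply: computable_shift => //; apply: computable_succ; apply: computable_codehead.
Qed.

Lemma size_code s : size s <= code s.
Proof.
elim: s => //= n s IHs; apply: (leq_trans _ (leq_pmull _ _)); rewrite ?expn_gt0 //.
by rewrite ltnS (leq_trans IHs) // -addnn leq_addr.
Qed.

Definition codedrop k c := iteri k (fun _ z => codetail z) c.

Lemma codedropE k s : codedrop k (code s) = code (drop k s).
Proof.
elim: k => [|k IHk] /=; first by rewrite drop0.
by rewrite /codedrop /= -/(codedrop _ _) IHk /codetail codeK -drop1 drop_drop.
Qed.

Lemma word_code_cat (X : finType) (u v : seq X) :
  word_code (u ++ v) = codecat (word_code u) (word_code v).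
Proof. by rewrite /word_code map_cat codecatE. Qed.

(** The letters are read off by repeatedly dropping the first entry of the code,
and their images are appended to an accumulator. *)
Lemma computable_flatten_map (X Y : finType) (g : X -> seq Y) :
  computable (fun u : seq X => [tuple word_code u])
    (fun u => word_code (flatten (map g u))).
Proof.
pose T := nth 0 [seq word_code (g x) | x <- enum X].
have TE x : T (enum_rank x) = word_code (g x).
  by rewrite /T (nth_map x) -?cardE // nth_enum_rank.
(* Past the end of the word the head of the code is 0, which is also the code
   of a letter: the first factor removes this spurious contribution. *)
pose piece k c := (0 < codedrop k c) * T (codehead (codedrop k c)).
apply: (@eq_computable _ _ _ (fun u =>
  iteri (word_code u) (fun k z => codecat z (piece k (word_code u))) 0)) => [u|].
  have uE : take (word_code u) u = u.
    by rewrite take_oversize // -(size_map (fun x => enum_rank x : nat)) size_code.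
  (* A word is not longer than its code, so the code bounds the iteration. *)
  transitivity (word_code (flatten (map g (take (word_code u) u)))); last first.
    by rewrite uE.
  elim: {1 3}(word_code u) => [|k IHk] /=; first by rewrite take0.
  rewrite IHk -addn1 takeD map_cat flatten_cat word_code_cat; congr codecat.
  rewrite /piece codedropE -map_drop /codehead codeK.
  case: (drop k u) => [|x v] //=; rewrite take0 cats0 TE.
  by rewrite muln_gt0 expn_gt0 mul1n.
have cpiece : computable2 piece.
  have cdrop : computable2 codedrop.
    apply: computable_iteri; [exact: computable_fst | exact: computable_snd |].
    by apply: computable_codetail; apply: (computable_weaken (computable_head _)).
  apply: computable_mul; first exact: computable_pos.
  apply: (computable_comp1 (c := id) (computable_nth _)).
  exact: computable_codehead.
apply: (computable_comp1 (c := id) (phi := @word_code X)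
  (g := fun c => iteri c (fun k z => codecat z (piece k c)) 0)); last first.
  by exists (MuProj ord0) => u.
apply: computable_iteri; [exact: computable_id | exact: computable_const |].
apply: computable_codecat; first exact: (computable_weaken (computable_head _)).
apply: (computable_comp2 cpiece); first exact: computable_head.
exact: (computable_weaken (computable_weaken computable_id)).
Qed.

(** * Deciding the congruence of a homogeneous presentation *)

Lemma cong_size (L : finType) (R : seq (seq L * seq L)) u v :
  homogeneous R -> cong R u v -> size u = size v.
Proof.
move=> hR; elim=> {u v} [u v /hR //|//|//|u v w _ -> //|u u' v v' _ uu' _ vv'].
by rewrite !size_cat uu' vv'.
Qed.

Definition letter_code {X : finType} (x : X) : nat := enum_rank x.

Lemma letter_code_inj (X : finType) : injective (@letter_code X).
Proof. by move=> x y /val_inj /enum_rank_inj. Qed.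

Lemma word_code_inj (X : finType) : injective (@word_code X).
Proof.
by move=> u v /(can_inj codeK); apply: inj_map; apply: letter_code_inj.
Qed.

Section CongruenceTest.

Variables (L : finType) (R : seq (seq L * seq L)).

Definition sandwich a (w : seq L) b := codecat a (codecat (word_code w) b).

Lemma sandwich_code s w s' :
  sandwich (code s) w (code s') = code (s ++ map letter_code w ++ s').
Proof. by rewrite /sandwich !codecatE. Qed.

Lemma sandwichE p w s :
  sandwich (word_code p) w (word_code s) = word_code (p ++ w ++ s).
Proof. by rewrite /sandwich !word_code_cat. Qed.

Definition sym_rels := R ++ [seq (r.2, r.1) | r <- R].

Lemma cong_sym_rels r : r \in sym_rels -> cong R r.1 r.2.
Proof.
case: r => u v; rewrite mem_cat => /orP[|/mapP[[u' v'] Ruv [-> ->]]].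
  exact: cong_rel.
exact/cong_sym/cong_rel.
Qed.

(** Counts the ways in which the set t fails to contain c and to be closed under
applying a relation between two contexts a and b. Bounding the contexts by t
loses nothing: an element of the set t is at most t, and a context is at most
the code of the whole word. *)
Definition violations t c :=
  (1 - bit c t) +
  \sum_(a < t.+1) \sum_(b < t.+1) \sum_(r <- sym_rels)
    (bit (sandwich a r.1 b) t - bit (sandwich a r.2 b) t).

Lemma leq_sandwich a w b :
  (a <= sandwich a w b) && (b <= sandwich a w b).
Proof.
rewrite /sandwich /codecat leq_addr /=; set p := 2 ^ _; set q := 2 ^ _.
have pq : 0 < p * q by rewrite muln_gt0 !expn_gt0.
rewrite mulnDr mulnA addnCA; apply: leq_trans (leq_addl _ _).
by rewrite addnC (leq_trans (leq_pmull _ pq)) ?leq_addl //; nia.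
Qed.

Lemma violations_eq0 t c :
  violations t c = 0 <->
  bit c t /\ (forall a b r, r \in sym_rels ->
    bit (sandwich a r.1 b) t -> bit (sandwich a r.2 b) t).
Proof.
split=> [/eqP|[ct closed]]; last first.
  rewrite /violations ct; apply/eqP; rewrite /= sum_nat_eq0.
  apply/forallP => a; rewrite sum_nat_eq0; apply/forallP => b.
  rewrite sum_nat_seq_eq0; apply/allP => r /(closed a b) /=.
  by case: bit => // ->.
rewrite addn_eq0 => /andP[]; rewrite subn_eq0 lt0b => ct.
rewrite sum_nat_eq0 => /forallP closed; split=> // a b r rR bt.
have /andP[lea leb] := leq_sandwich a r.1 b.
have le_t := bit_leq bt.
have := closed (Ordinal (leq_trans lea le_t : a < t.+1)).
rewrite sum_nat_eq0 => /forallP /(_ (Ordinal (leq_trans leb le_t : b < t.+1))).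
by rewrite sum_nat_seq_eq0 => /allP /(_ _ rR) /=; rewrite bt; case: bit.
Qed.

(** A set closed under the relations is closed under the congruence. The
induction needs the words in an arbitrary context, because of concatenation. *)
Lemma violations_cong t u v :
  violations t (word_code u) = 0 -> cong R u v -> bit (word_code v) t.
Proof.
move=> /violations_eq0[ut closed] uv.
suff step u' v' p s : cong R u' v' ->
    bit (word_code (p ++ u' ++ s)) t = bit (word_code (p ++ v' ++ s)) t.
  by have := step _ _ [::] [::] uv; rewrite !cats0 /= ut => <-.
move=> uv'; elim: uv' p s => {u v u' v' uv ut}
  [u v Ruv p s|//|u v _ IH p s|u v w _ IH1 _ IH2 p s|u u' v v' _ IH1 _ IH2 p s].
- apply/idP/idP; rewrite -!sandwichE.
    by apply: (closed _ _ (u, v)); rewrite mem_cat Ruv.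
  apply: (closed _ _ (v, u)); rewrite mem_cat; apply/orP; right.
  by apply/mapP; exists (u, v).
- by rewrite IH.
- by rewrite IH1.
by rewrite -!catA IH1 !(catA p) IH2.
Qed.

(** Congruent words have the same length, so a class is finite. *)
Lemma class_number (hR : homogeneous R) u :
  {t | forall c, bit c t = `[< exists2 v, cong R u v & word_code v = c >]}.
Proof.
apply/cid/(bits_exist (N := (\max_(v : (size u).-tuple L) word_code v).+1)).
move=> c /asboolP[v /(cong_size hR)/esym/eqP sz_v <-].
by rewrite ltnS; apply: (leq_bigmax (Tuple sz_v)).
Qed.

Lemma code_onto c : exists s, code s = c.
Proof. by exists (decode c); rewrite decodeK. Qed.

(** The contexts of a relation are arbitrary codes in the closure condition; if
the resulting sequence codes a word, they are codes of words as well. *)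
Lemma class_number_closed (hR : homogeneous R) u :
  violations (sval (class_number hR u)) (word_code u) = 0.
Proof.
case: class_number => t tE /=; apply/violations_eq0; split=> [|a b r rR].
  by rewrite tE; apply/asboolP; exists u => //; apply: cong_refl.
rewrite !tE => /asboolP[v uv vE]; apply/asboolP.
have [[s sE] [s' sE']] := (code_onto a, code_onto b); subst a b.
rewrite sandwich_code in vE; move/(can_inj codeK): vE => vE.
have vp : map letter_code (take (size s) v) = s by rewrite map_take vE take_size_cat.
have vr : map letter_code (drop (size s) v) = map letter_code r.1 ++ s'.
  by rewrite map_drop vE drop_size_cat.
have vr1 : take (size r.1) (drop (size s) v) = r.1.
  apply: (inj_map (@letter_code_inj L)).
  by rewrite map_take vr take_size_cat ?size_map.
exists (take (size s) v ++ r.2 ++ drop (size r.1) (drop (size s) v)).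
  apply: (cong_trans uv).
  rewrite -{1}[v](cat_take_drop (size s)).
  apply: cong_cat; first exact: cong_refl.
  rewrite -{1}[drop (size s) v](cat_take_drop (size r.1)) vr1.
  by apply: cong_cat; [apply: cong_sym_rels | apply: cong_refl].
rewrite sandwich_code /word_code !map_cat; congr (code (_ ++ _ ++ _)) => //.
by rewrite -/(map letter_code _) map_drop vr drop_size_cat ?size_map.
Qed.

Lemma computable_violations : computable2 violations.
Proof.
apply: computable_add.
  apply: computable_sub; first exact: computable_const.
  by apply: computable_bit; [exact: computable_snd | exact: computable_fst].
apply: (computable_sum (b := fun p => p.1.+1)
  (H := fun a p => \sum_(b < p.1.+1) \sum_(r <- sym_rels)
    (bit (sandwich a r.1 b) p.1 - bit (sandwich a r.2 b) p.1))).
  exact: (computable_succ computable_fst).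
apply: (computable_sum (b := fun p => p.2.1.+1)
  (H := fun b p => \sum_(r <- sym_rels)
    (bit (sandwich p.1 r.1 b) p.2.1 - bit (sandwich p.1 r.2 b) p.2.1))).
  exact: (computable_succ (computable_weaken computable_fst)).
have ct : computable (ext (ext (fun p : nat * nat => [tuple p.1; p.2])))
    (fun p => p.2.2.1) := computable_weaken (computable_weaken computable_fst).
have csandwich w :
    computable (ext (ext (fun p : nat * nat => [tuple p.1; p.2])))
      (fun p => sandwich p.2.1 w p.1).
  apply: computable_codecat; first exact: (computable_weaken (computable_head _)).
  by apply: computable_codecat; [exact: computable_const | exact: computable_head].
apply: computable_sum_seq => r.
by apply: computable_sub; apply: computable_bit => //; apply: csandwich.
Qed.

(** The class of u is the least closed set containing u, hence is found by
minimization; it then suffices to test whether it contains v. *)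
Lemma computable_cong (hR : homogeneous R) :
  computable (fun p : seq L * seq L => [tuple word_code p.1; word_code p.2])
    (fun p => `[< cong R p.1 p.2 >] : nat).
Proof.
pose N u := sval (class_number hR u).
have cN : computable (fun u : seq L => [tuple word_code u]) N.
  apply: (computable_min (g := fun t u => violations t (word_code u))).
  - apply: (computable_comp2 computable_violations); first exact: computable_head.
    by apply: computable_weaken; exists (MuProj ord0).
  - exact: class_number_closed.
  move=> u t; apply: contraTN => /eqP t0; rewrite -leqNgt.
  apply: leq_bits => c; rewrite /N; case: class_number => n /= -> /asboolP[v uv <-].
  exact: violations_cong t0 uv.
apply: (@eq_computable _ _ _ (fun p => bit (word_code p.2) (N p.1))) => [[u v]|].
  rewrite /N; case: class_number => n /= ->; congr nat_of_bool.
  apply/asboolP/asboolP => [[w uw /word_code_inj <- //]|uv].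
  by exists v.
apply: computable_bit; first by exists (MuProj (lift ord0 ord0)).
by apply: (computable_comp1 (phi := fst) cN); exists (MuProj ord0).
Qed.

End CongruenceTest.

(** * Decidable relations between words *)

Definition pair_code (X : finType) (p : seq X * seq X) :=
  [tuple word_code p.1; word_code p.2].

Lemma decidable_wordsE (X : finType) (P : seq X -> seq X -> Prop) :
  decidable_words P <->
  computable (@pair_code X) (fun p => `[< P p.1 p.2 >] : nat).
Proof.
split=> [[m mP]|[m mP]]; exists m.
  move=> [u v]; have [b] := mP u v; rewrite /pair_code /=; case: b => bE [Pt Pf].
    by rewrite (asboolT (Pt isT)).
  by rewrite asboolF // => /Pf.
by move=> u v; exists `[< P u v >]; [apply: (mP (u, v)) | split=> /asboolP].
Qed.

Lemma decidable_reduction (X Y : finType) (P : seq X -> seq X -> Prop)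
    (Q : seq Y -> seq Y -> Prop) (h1 h2 : seq X * seq X -> seq Y) :
  computable (@pair_code X) (fun p => word_code (h1 p)) ->
  computable (@pair_code X) (fun p => word_code (h2 p)) ->
  (forall p, P p.1 p.2 <-> Q (h1 p) (h2 p)) ->
  decidable_words Q -> decidable_words P.
Proof.
move=> c1 c2 PQ; rewrite !decidable_wordsE => cQ.
apply: (@eq_computable _ _ _ (fun p => `[< Q (h1 p) (h2 p) >] : nat)) => [p|].
  by congr nat_of_bool; apply/asboolP/asboolP => /PQ.
apply: (computable_comp (phi := fun p => (h1 p, h2 p))
  (h := fun (j : 'I_2) p => word_code (if j == ord0 then h1 p else h2 p)) cQ).
  by move=> j; case: (j == ord0).
by move=> p [[|[|j]] lej] //; rewrite (tnth_nth 0).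
Qed.

Lemma computable_word_fst (X : finType) :
  computable (@pair_code X) (fun p => word_code p.1).
Proof. by exists (MuProj ord0). Qed.

Lemma computable_word_snd (X : finType) :
  computable (@pair_code X) (fun p => word_code p.2).
Proof. by exists (MuProj (lift ord0 ord0)). Qed.

(** The shape of every reduction below: a letterwise translation of one of the
two input words, followed by a letterwise translation of the other. *)
Lemma computable_translations (X Y : finType) (g g' : X -> seq Y)
    (h h' : seq X * seq X -> seq X) :
  computable (@pair_code X) (fun p => word_code (h p)) ->
  computable (@pair_code X) (fun p => word_code (h' p)) ->
  computable (@pair_code X)
    (fun p => word_code (flatten (map g (h p)) ++ flatten (map g' (h' p)))).
Proof.
move=> ch ch'; apply: (eq_computable (fun p => esym (word_code_cat _ _))).
apply: computable_codecat.
  exact: (computable_comp1 (computable_flatten_map g) ch).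
exact: (computable_comp1 (computable_flatten_map g') ch').
Qed.

Local Open Scope group_scope.

(** * A central common multiple of the letters *)

(** The iterates of f are among the finitely many maps from T to itself. *)
Lemma ltn_iter_eq (T : finType) (f : T -> T) :
  exists i j, i < j /\ iter i f =1 iter j f.
Proof.
pose F (k : 'I_#|{ffun T -> T}|.+1) := [ffun x => iter k f x].
have /injectivePn[i [j neq_ij /ffunP Fij]] : ~~ injectiveb F.
  by apply/injectiveP => /leq_card; rewrite card_ord ltnn.
have ij : iter i f =1 iter j f by move=> x; have := Fij x; rewrite !ffunE.
case: (ltngtP i j) => [ltij|ltji|/val_inj eq_ij].
- by exists i, j.
- by exists j, i; split=> // x; rewrite ij.
by rewrite eq_ij eqxx in neq_ij.
Qed.

Section Localization.

Variables (L : finType) (R : seq (seq L * seq L)).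
Hypothesis hR : homogeneous R.
Local Notation M := (pres_monoid R).
Local Notation cl := (wclass R).

Lemma wclass_cat u v : cl (u ++ v) = cl u * cl v.
Proof. by apply: esym; apply: pres_mulE. Qed.

Lemma wclass_nil : cl [::] = 1.
Proof. by []. Qed.

Lemma wclass_cons x u : cl (x :: u) = cl [:: x] * cl u.
Proof. by rewrite -wclass_cat. Qed.

Lemma wclass_size u v : cl u = cl v -> size u = size v.
Proof. by move=> /wclass_eq /(cong_size hR). Qed.

Lemma atom_letter x : @atom M (cl [:: x]).
Proof.
split=> [/(@wclass_size [:: x] [::]) //|a b].
rewrite -[a]wclass_repr -[b]wclass_repr -wclass_cat => /wclass_size.
rewrite size_cat; case: (repr a) => [|y a'] /=; first by move=> _; left.
by move=> [] /esym/eqP; rewrite addn_eq0 => /andP[_ /nilP->]; right.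
Qed.

Lemma atomP (s : M) : atom s -> exists x, s = cl [:: x].
Proof.
rewrite -[s]wclass_repr; case: (repr s) => [|x u] [sn1 sP]; first by case: sn1.
exists x; move: sP; rewrite wclass_cons => /(_ _ _ erefl).
case=> [/(@wclass_size [:: x] [::])//|->].
by rewrite mulg1.
Qed.

Hypothesis hC : cancellative M.

Lemma mulIM (a x y : M) : x * a = y * a -> x = y.
Proof. by move=> xy; apply: (hC (a := 1) (b := a)); rewrite !mul1g. Qed.

Lemma mulMI (a x y : M) : a * x = a * y -> x = y.
Proof. by move=> xy; apply: (hC (a := a) (b := 1)); rewrite !mulg1. Qed.

(** If D = x D_x = D_x sigma(x), then x D = x D_x sigma(x) = D sigma(x). *)
Lemma fundamental_intertwines (D : M) : fundamental D ->
  forall x, exists y, cl [:: x] * D = D * cl [:: y].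
Proof.
move=> [_ [sigma [sigma_atom _ _] sigmaP]] x.
have [Ds [DE DE']] := sigmaP _ (atom_letter x).
have [y yE] := atomP (sigma_atom _ (atom_letter x)).
by exists y; rewrite -yE {1}DE' DE mulgA -mulgA.
Qed.

(** With x D^k = D^k f^k(x) and f^i = f^j, one has
x D^j = D^j f^i(x) = D^(j - i) x D^i, and D^i can be cancelled. *)
Lemma fundamental_power_central (D : M) : fundamental D ->
  exists2 p, 0 < p & forall a : M, a * D ^+ p = D ^+ p * a.
Proof.
move=> fD.
have /choice[f fP] := fundamental_intertwines fD.
have fiter k x : cl [:: x] * D ^+ k = D ^+ k * cl [:: iter k f x].
  elim: k => [|k IHk]; first by rewrite expg0 mul1g mulg1.
  by rewrite expgSr mulgA IHk -!mulgA fP.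
have [i [j [ltij fij]]] := ltn_iter_eq f.
exists (j - i)%N; rewrite ?subn_gt0 // => a.
have letter x : cl [:: x] * D ^+ (j - i) = D ^+ (j - i) * cl [:: x].
  apply: (mulIM (a := D ^+ i)).
  rewrite -!mulgA -expgnDr subnK ?(ltnW ltij) // fiter -fij.
  by rewrite fiter mulgA -expgnDr subnK ?(ltnW ltij).
rewrite -[a]wclass_repr; elim: (repr a) => [|x u IHu].
  by rewrite wclass_nil mul1g mulg1.
by rewrite wclass_cons -mulgA IHu !mulgA letter.
Qed.

(** The word c x is a cofactor of x in a central power of D: D = x D_x gives
D^p = x (D_x D^(p - 1)). *)
Lemma central_denominator : (@fundamental M !=set0)%classic ->
  exists (z : seq L) (c : L -> seq L),
    (forall a : M, a * cl z = cl z * a) /\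
    (forall x, cl (x :: c x) = cl z).
Proof.
move=> [D fD]; have [p p_gt0 pC] := fundamental_power_central fD.
have /choice[c cP] x : exists u, cl (x :: u) = D ^+ p.
  have [_ [sigma _ /(_ _ (atom_letter x))[Ds [DE _]]]] := fD.
  exists (repr (Ds * D ^+ p.-1)); rewrite wclass_cons wclass_repr mulgA -DE.
  by rewrite -expgS prednK.
by exists (repr (D ^+ p)), c; rewrite wclass_repr.
Qed.

(** * Group words as fractions *)

Variables (z : seq L) (c : L -> seq L).
Hypothesis zC : forall a : M, a * cl z = cl z * a.
Hypothesis cz : forall x, cl (x :: c x) = cl z.

(** The inverse letter x^-1 is read as the fraction c x / z. *)
Definition num_letter (l : L * bool) := if l.2 then c l.1 else [:: l.1].
Definition den_letter (l : L * bool) := if l.2 then z else [::].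
Definition num w := flatten (map num_letter w).
Definition den w := flatten (map den_letter w).

Lemma num_cat u v : cl (num (u ++ v)) = cl (num u) * cl (num v).
Proof. by rewrite /num map_cat flatten_cat wclass_cat. Qed.

Lemma den_cat u v : cl (den (u ++ v)) = cl (den u) * cl (den v).
Proof. by rewrite /den map_cat flatten_cat wclass_cat. Qed.

Lemma den_central w (a : M) : a * cl (den w) = cl (den w) * a.
Proof.
elim: w => [|l w IHw]; first by rewrite wclass_nil mul1g mulg1.
rewrite -cat1s den_cat mulgA; have -> : a * cl (den [:: l]) = cl (den [:: l]) * a.
  by case: l => x []; rewrite /den /= ?cats0 ?zC // wclass_nil mul1g mulg1.
by rewrite -!mulgA IHw.
Qed.

Lemma num_pos_word u : num (pos_word u) = u.
Proof. by rewrite /num /pos_word -map_comp /=; elim: u => //= x u ->. Qed.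

Lemma den_pos_word u : den (pos_word u) = [::].
Proof. by rewrite /den /pos_word -map_comp /=; elim: u. Qed.

Lemma cofactorC x : cl (c x) * cl [:: x] = cl z.
Proof.
apply: (mulMI (a := cl [:: x])).
by rewrite mulgA -(wclass_cons x (c x)) cz zC.
Qed.

(** Both sides are w and w' brought to a common denominator, so this says that
equal group elements have equal fractions, already in the monoid. *)
Lemma fraction_cong w w' : cong (group_rels R) w w' ->
  cl (num w) * cl (den w') = cl (num w') * cl (den w).
Proof.
elim=> {w w'} [w w'|//|//|w2 w1 w3 _ IH12 _ IH23|u u' v v' _ IHu _ IHv].
- (* A relation of the presentation, or the free cancellation of x^b x^-b. *)
  rewrite mem_cat => /orP[/mapP[[u v] Ruv [-> ->]]|/mapP[[x b] _ [-> ->]]].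
    rewrite !num_pos_word !den_pos_word; congr (_ * _).
    exact/wclass_eq/cong_rel.
  rewrite /num /den /neg_letter; case: b; rewrite /= !cats0 wclass_nil mulg1 mul1g.
    by rewrite wclass_cat cofactorC.
  by rewrite cz.
- apply: (mulIM (a := cl (den w2))).
  rewrite -mulgA (den_central w2 (cl (den w3))) mulgA IH12.
  rewrite -mulgA -(den_central w1) mulgA IH23.
  by rewrite -!mulgA (den_central w1).
rewrite !num_cat !den_cat.
rewrite -!mulgA (mulgA (cl (num v))) (den_central u') -!mulgA IHv.
by rewrite !mulgA IHu -!mulgA (mulgA (cl (den u))) -(den_central u) !mulgA.
Qed.

Local Notation loc := (@localization L R).

(** Positive words have denominator 1. *)
Lemma localization_inj : injective loc.
Proof.
move=> a b; rewrite -[a]wclass_repr -[b]wclass_repr !localizationE.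
move=> /wclass_eq/fraction_cong.
by rewrite !num_pos_word !den_pos_word wclass_nil !mulg1.
Qed.

Lemma gclass_cat u v : gclass R (u ++ v) = gclass R u * gclass R v.
Proof. by apply: esym; apply: pres_mulE. Qed.

Lemma locM a b : loc (a * b) = loc a * loc b.
Proof. exact: localizationM. Qed.

Lemma gclass_fraction w : gclass R w * loc (cl (den w)) = loc (cl (num w)).
Proof.
elim: w => [|l w IHw]; first by rewrite /num /den /= wclass_nil !localization1 mulg1.
rewrite -cat1s gclass_cat num_cat den_cat -den_central !locM.
rewrite -mulgA (mulgA (gclass R w)) IHw -!locM den_central !locM mulgA; congr (_ * _).
rewrite /num /den; case: l => x [] /=; rewrite ?cats0; last first.
  by rewrite wclass_nil localization1 mulg1 localizationE.
have inv_x : gclass R [:: (x, true)] * loc (cl [:: x]) = 1.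
  rewrite localizationE -gclass_cat.
  by apply/wclass_eq/(cong_Vword R [:: (x, false)]).
by rewrite -(cz x) wclass_cons locM mulgA inv_x mul1g.
Qed.

Lemma gclass_eq u v : gclass R u = gclass R v <->
  cl (num u ++ den v) = cl (num v ++ den u).
Proof.
rewrite !wclass_cat; split=> [/wclass_eq/fraction_cong //|uv].
apply: (mulIg (loc (cl (den u) * cl (den v)))).
rewrite {2}(den_central v) !locM !mulgA !gclass_fraction.
by rewrite -!locM uv.
Qed.

(** A denominator commutes with all numerators and denominators, hence with all
fractions. *)
Lemma loc_den_central w (g : pres_group R) :
  g * loc (cl (den w)) = loc (cl (den w)) * g.
Proof.
rewrite -[g]wclass_repr -/(gclass R _); set u := repr g.
apply: (mulIg (loc (cl (den u)))).
rewrite -!mulgA gclass_fraction -!locM den_central !locM mulgA gclass_fraction.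
by rewrite -!locM den_central.
Qed.

(** The equation in the monoid is the one in the group multiplied by the common
denominator of u and v, which is central and can be cancelled. *)
Lemma intertwine_num u v (a : M) :
  a * cl (num u ++ den v) = cl (num v ++ den u) * a <->
  loc a * gclass R u = gclass R v * loc a.
Proof.
have -> : (a * cl (num u ++ den v) = cl (num v ++ den u) * a) <->
   (loc a * gclass R u * loc (cl (den u) * cl (den v)) =
    gclass R v * loc a * loc (cl (den u) * cl (den v))).
  have -> : loc a * gclass R u * loc (cl (den u) * cl (den v)) =
      loc (a * cl (num u ++ den v)).
    by rewrite wclass_cat !locM -gclass_fraction !mulgA.
  have -> : gclass R v * loc a * loc (cl (den u) * cl (den v)) =
      loc (cl (num v ++ den u) * a).
    rewrite wclass_cat !locM -gclass_fraction -!mulgA; congr (_ * _).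
    by rewrite -!locM -(den_central u a) -(den_central v) mulgA.
  by split=> [->|/localization_inj].
by split=> [/mulIg|->].
Qed.

(** The denominator of a conjugating element is central, so its numerator
conjugates in the same way. *)
Lemma gclass_conj u v :
  (exists g : pres_group R, gclass R v = gclass R u ^ g) <->
  (exists a : M, a * cl (num u ++ den v) = cl (num v ++ den u) * a).
Proof.
split=> [[g vE]|[a /intertwine_num aE]]; last first.
  by exists (loc a)^-1; rewrite conjgE invgK mulgA aE mulgK.
pose w := repr (g^-1); have gE : gclass R w = g^-1 by apply: wclass_repr.
exists (cl (num w)); apply/intertwine_num.
rewrite -gclass_fraction gE -mulgA -loc_den_central vE conjgE.
by rewrite -!mulgA mulVKg.
Qed.

End Localization.

(** * Solvability of the word and conjugacy problems *)

Section Decision.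

Variables (L : finType) (R : seq (seq L * seq L)).
Hypotheses (hR : homogeneous R) (hC : cancellative (pres_monoid R)).
Variables (z : seq L) (c : L -> seq L).
Hypothesis zC : forall a : pres_monoid R, a * wclass R z = wclass R z * a.
Hypothesis cz : forall x, wclass R (x :: c x) = wclass R z.

Lemma word_problem : word_problem_solvable R.
Proof.
have c1 := computable_translations (num_letter c) (den_letter z)
  (@computable_word_fst _) (@computable_word_snd _).
have c2 := computable_translations (num_letter c) (den_letter z)
  (@computable_word_snd _) (@computable_word_fst _).
apply: (decidable_reduction c1 c2 (Q := cong R)) => [[u v]|] /=.
  by rewrite (gclass_eq hC zC cz) wclass_eq.
exact/decidable_wordsE/computable_cong.
Qed.

Lemma group_conjugacy_reduction :
  monoid_conjugacy_solvable R -> group_conjugacy_solvable R.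
Proof.
rewrite /monoid_conjugacy_solvable /group_conjugacy_solvable.
have c1 := computable_translations (num_letter c) (den_letter z)
  (@computable_word_fst _) (@computable_word_snd _).
have c2 := computable_translations (num_letter c) (den_letter z)
  (@computable_word_snd _) (@computable_word_fst _).
apply: (decidable_reduction c1 c2) => -[u v]; exact: (gclass_conj hC zC cz u v).
Qed.

Lemma monoid_conjugacy_reduction :
  group_conjugacy_solvable R -> monoid_conjugacy_solvable R.
Proof.
rewrite /monoid_conjugacy_solvable /group_conjugacy_solvable.
pose pos (x : L) := [:: (x, false)]; pose none (x : L) : seq (L * bool) := [::].
have c1 := computable_translations pos none
  (@computable_word_fst _) (@computable_word_snd _).
have c2 := computable_translations pos none
  (@computable_word_snd _) (@computable_word_fst _).
have posE (u v : seq L) :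
    flatten (map pos u) ++ flatten (map none v) = pos_word u.
  have -> : flatten (map none v) = [::] by elim: v.
  by rewrite cats0 /pos_word; elim: u => //= x u ->.
apply: (decidable_reduction c1 c2) => -[u v] /=.
rewrite !posE.
split=> [|/(gclass_conj hC zC cz)]; last first.
  by rewrite !num_pos_word !den_pos_word !cats0.
move=> uv; apply/(gclass_conj hC zC cz).
by rewrite !num_pos_word !den_pos_word !cats0.
Qed.

End Decision.

Local Open Scope classical_set_scope.

Theorem lemma2p11 (L : finType) (R : seq (seq L * seq L))
    (R_homogeneous : homogeneous R)
    (G_cancellative : cancellative (pres_monoid R))
    (F_neq0 : @fundamental (pres_monoid R) !=set0) :
  [/\ injective (@localization L R),
      word_problem_solvable R
    & monoid_conjugacy_solvable R <-> group_conjugacy_solvable R].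
Proof.
have [z [c [zC cz]]] := central_denominator R_homogeneous G_cancellative F_neq0.
split.
- exact: (localization_inj G_cancellative zC cz).
- exact: (word_problem R_homogeneous G_cancellative zC cz).
split; first exact: (group_conjugacy_reduction G_cancellative zC cz).
exact: (monoid_conjugacy_reduction G_cancellative zC cz).
Qed.
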